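(* Let $\mathcal{X},\mathcal{Y},\mathcal{Z}$ be sets, $\mathcal{G}$ a measurable space of maps $\mathcal{X}\to\mathcal{Z}$, $\mathcal{H}$ a set of maps $\mathcal{Z}\to\mathbb{R}$, $\ell$ a loss, and fix a within-task online algorithm such that for every $g\in\mathcal{G}$ and every sequence $((x_1,y_1),\dots,(x_m,y_m))\in(\mathcal{X}\times\mathcal{Y})^m$ its average loss $\hat L(g)=\frac1m\sum_{i=1}^m\ell(h_i^g\circ g(x_i),y_i)$ lies in $[0,C]$ and satisfies $\hat L(g)-\inf_{h\in\mathcal{H}}\frac1m\sum_{i=1}^m\ell(h\circ g(x_i),y_i)\le\beta(g,m)$. Let $Q$ be a distribution over distributions on $\mathcal{X}\times\mathcal{Y}$; draw $P_1,\dots,P_T$ i.i.d. from $Q$ and, for each $t$, a sample $(x_{t,i},y_{t,i})_{1\le i\le m}$ i.i.d. from $P_t$. Consider the strategy: (1) run EWA-LL with prior $\pi_1$ and parameter $\eta>0$ on the tasks $t=1,\dots,T$, obtaining $\hat g_1,\dots,\hat g_T$; (2) draw $\mathcal{T}$ uniformly in $\{1,\dots,T\}$ and set $\hat g=\hat g_{\mathcal{T}}$; (3) given a new $P\sim Q$ and a sample $(x_i,y_i)_{1\le i\le m}$ i.i.d. from $P$, run the within-task algorithm with representation $\hat g$ on this sample, obtaining $h_1^{\hat g},\dots,h_m^{\hat g}$; (4) draw $\mathcal{I}$ uniformly in $\{1,\dots,m\}$ and set $\hat h=h^{\hat g}_{\mathcal{I}}$. Let $\mathbb{E}$ denote the expectation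 over all the data, over $P_1,\dots,P_T,P$, over a test pair $(x,y)\sim P$, and over the learner's randomization $(\hat g_t)_t,\mathcal{T},\mathcal{I}$. Then $$\mathbb{E}\big[\ell(\hat h\circ\hat g(x),y)\big]\le\inf_\rho\Bigg\{\mathbb{E}_{g\sim\rho}\Bigg[\mathbb{E}_{P\sim Q}\inf_{h\in\mathcal{H}}\mathbb{E}_{(x,y)\sim P}\big[\ell(h\circ g(x),y)\big]+\beta(g,m)\Bigg]+\frac{\eta C^2}{8}+\frac{\mathcal{K}(\rho,\pi_1)}{\eta T}\Bigg\},$$ the infimum being over all probability measures $\rho$ on $\mathcal{G}$, with $\mathcal{K}$ the Kullback–Leibler divergence.
   Context: Within-task online algorithm: given $g\in\mathcal{G}$ and a sequence $((x_1,y_1),\dots,(x_m,y_m))$, it outputs functions $h_1^g,\dots,h_m^g:\mathcal{Z}\to\mathbb{R}$ where $h_i^g$ depends only on $g$ and $(x_1,y_1),\dots,(x_{i-1},y_{i-1})$; its prediction on $x_i$ is $h_i^g\circ g(x_i)$. The same algorithm is used for every task. EWA-LL on tasks $t=1,\dots,T$: for $t=1,\dots,T$, draw $\hat g_t\sim\pi_t$, run the within-task algorithm on task $t$'s sample with $\hat g_t$, and set $\pi_{t+1}(\mathrm{d}g)\propto\exp(-\eta\hat L_t(g))\pi_t(\mathrm{d}g)$, where $\hat L_t(g)$ is the within-task average loss on task $t$'s sample with representation $g$. Measurability of all maps involved is assumed. *)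

(* Defs.v *)
From HB Require Import structures.
From mathcomp Require Import all_boot all_order all_algebra.
From mathcomp Require Import all_classical all_reals all_analysis.
From mathcomp Require Import measurable_realfun.
Set Implicit Arguments. Unset Strict Implicit. Unset Printing Implicit Defensive.
Import Order.TTheory GRing.Theory Num.Theory.
Local Open Scope classical_set_scope.
Local Open Scope ring_scope.

Section defs.
Context {R : realType}.

Fixpoint iidE {d} {T : measurableType d} (P : {measure set T -> \bar R})
  (n : nat) : (n.-tuple T -> \bar R) -> \bar R :=
  match n return (n.-tuple T -> \bar R) -> \bar R with
  | 0 => fun F => F [tuple]
  | n'.+1 => fun F => (\int[P]_z @iidE d T P n' (fun s : n'.-tuple T => F (cons_tuple z s)))%E
  end.

Fixpoint tasksE {d} {U : measurableType d} (Q : probability (pprobability U R) R)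
  (m T : nat) : (seq (m.-tuple U) -> \bar R) -> \bar R :=
  match T with
  | 0 => fun F => F [::]
  | T'.+1 => fun F =>
      (\int[Q]_P iidE (P : probability U R) (fun S : m.-tuple U =>
          @tasksE d U Q m T' (fun D => F (S :: D))))%E
  end.

Context {dX dY dG : measure_display} {X : measurableType dX}
  {Y : measurableType dY} {Z : Type} {G : measurableType dG}.

(* app g : X -> Z is the map represented by g in the measurable space G.
   alg g s : Z -> R is the hypothesis output by the within-task online
   algorithm, with representation g, after having seen the pairs s
   (h_i^g = alg g (first i-1 pairs)). *)

Definition avg_loss (l : R -> Y -> R) (app : G -> X -> Z)
  (alg : G -> seq (X * Y) -> Z -> R) (m : nat) (g : G) (S : m.-tuple (X * Y)) : R :=
  m%:R^-1 * \sum_(i < m) l (alg g (take i S) (app g (tnth S i).1)) (tnth S i).2.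

Definition emp_loss (l : R -> Y -> R) (app : G -> X -> Z) (m : nat)
  (h : Z -> R) (g : G) (S : m.-tuple (X * Y)) : R :=
  m%:R^-1 * \sum_(i < m) l (h (app g (tnth S i).1)) (tnth S i).2.

(* Expectation under the EWA-LL distribution pi_{k+1} obtained after the
   tasks S_1..S_k (given in reverse order Dr = [S_k; ...; S_1]):
   pi_{t+1}(dg) = exp(-eta Lhat_t(g)) pi_t(dg) / int exp(-eta Lhat_t) d pi_t. *)
Fixpoint ewa_rev (pi1 : probability G R) (eta : R) (m : nat)
  (Lhat : G -> m.-tuple (X * Y) -> R) (Dr : seq (m.-tuple (X * Y)))
  (f : G -> \bar R) : \bar R :=
  match Dr with
  | [::] => (\int[pi1]_g f g)%E
  | S0 :: Dr' =>
      (ewa_rev pi1 eta Lhat Dr' (fun g => f g * (expR (- (eta * Lhat g S0)))%:E) *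
       (ewa_rev pi1 eta Lhat Dr' (fun g => (expR (- (eta * Lhat g S0)))%:E))^-1)%E
  end.

Definition ewaE (pi1 : probability G R) (eta : R) (m : nat)
  (Lhat : G -> m.-tuple (X * Y) -> R) (D : seq (m.-tuple (X * Y)))
  (f : G -> \bar R) : \bar R := ewa_rev pi1 eta Lhat (rev D) f.

End defs.
Arguments tasksE {R d U} Q m T _.

Definition KL {R : realType} {d} {G : measurableType d}
  (rho pi : probability G R) : \bar R :=
  if pselect (rho `<< pi)
  then (\int[rho]_g (ln (fine (Radon_Nikodym (charge_of_finite_measure rho) pi g)))%:E)%E
  else +oo%E.

(* Main.v *)
Require Import Defs.
From HB Require Import structures.
From mathcomp Require Import all_boot all_order all_algebra.
From mathcomp Require Import all_classical all_reals all_analysis.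
From mathcomp Require Import measurable_realfun.
From mathcomp Require Import ring lra.
Import Order.TTheory GRing.Theory Num.Theory.
Import numFieldNormedType.Exports.
Local Open Scope classical_set_scope.
Local Open Scope ring_scope.

(** Write V(g) for the expected average loss of the within-task algorithm on a
    fresh task with representation g. Since the i-th hypothesis only depends on
    the first i-1 pairs, the risk of the randomly chosen hypothesis is V(g), and
    the regret bound, integrated over a sample of P, gives
    V(g) <= E_P inf_h E_(x,y) l(h (g x), y) + beta(g,m). It remains to show that the
    EWA distributions pi_t satisfy
    E sum_t E_(pi_t) V <= T (E_rho V + eta C^2 / 8) + KL(rho, pi_1) / eta.
    With Z_D the normalising constant of EWA after the tasks D and U_D the
    cumulated loss, the potential KL(rho, pi_1) + ln Z_D + eta E_rho U_D is
    nonnegative by the Donsker-Varadhan inequality, and Hoeffding's lemma bounds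
    its increment on a new task S by
    eta (E_rho L_S - E_(pi_t) L_S + eta C^2 / 8). As S is independent of D, taking
    the expectation replaces L_S by V, and the increments telescope. *)

(** * Integrals and expectations over i.i.d. samples *)

Section integration.
Local Open Scope ereal_scope.
Context {R : realType}.

(** No measurability is required: the integral of a nonnegative function is a supremum over the
    simple functions below it, and those below [f] are below [g]. *)
Lemma ge0_le_lower_integral {d} {T : measurableType d}
    (mu : {measure set T -> \bar R}) (f g : T -> \bar R) :
  (forall x, 0 <= f x) -> (forall x, f x <= g x) ->
  \int[mu]_x f x <= \int[mu]_x g x.
Proof.
move=> f0 fg; rewrite !ge0_integralTE//; last first.
  by move=> x; exact: le_trans (f0 x) (fg x).
apply: le_ereal_sup => _ [h hf <-]; exists h => // x.
exact: le_trans (hf x) (fg x).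
Qed.

Lemma integral_cst_probability {d} {T : measurableType d} (P : probability T R)
    (c : \bar R) : \int[P]_x c = c.
Proof.
rewrite -[RHS]mule1 -(probability_setT P); exact: integral_cst.
Qed.

(** A measurable map into the space of probability measures is a probability kernel, so
    measurability of kernel integrals applies. *)
Lemma measurable_integral_pprobability {dA d} {A : measurableType dA}
    {T : measurableType d} (k : A -> pprobability T R) (F : A * T -> \bar R) :
  measurable_fun setT k -> measurable_fun setT F -> (forall x, 0 <= F x) ->
  measurable_fun setT (fun a => \int[(k a : probability T R)]_z F (a, z)).
Proof.
move=> mk mF F0.
exact: (@measurable_fun_integral_finite_kernel _ _ A T R F
  (kprobability mk) F0 mF).
Qed.

(* [f] need not be measurable, in which case [\int[P]_z f z] is its lower
   integral; the positive part of [F - K] is a measurable minorant of [f]. *)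
Lemma ge0_integral_le_cstD {d} {T : measurableType d} (P : probability T R)
    (F f : T -> \bar R) (K : \bar R) :
  measurable_fun setT F -> (forall z, 0 <= F z) -> (forall z, 0 <= f z) ->
  0 <= K -> (forall z, F z <= K + f z) ->
  \int[P]_z F z <= K + \int[P]_z f z.
Proof.
move=> mF F0 f0; case: K => [k| |]// k0 Fle; last first.
  by rewrite addye ?leey// gt_eqF// (lt_le_trans _ (integral_ge0 _ _)).
have mk : measurable_fun setT (fun z => F z - k%:E).
  by apply: emeasurable_funB.
apply: (@le_trans _ _ (\int[P]_z (k%:E + maxe (F z - k%:E) 0))).
  apply: ge0_le_lower_integral => // z.
  by rewrite -leeBlDl// le_max lexx.
rewrite ge0_integralD//; last 2 first.
- by move=> z _; rewrite le_max lexx orbT.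
- by apply: measurable_maxe.
rewrite integral_cst_probability leeD2l//.
apply: ge0_le_lower_integral => z; first by rewrite le_max lexx orbT.
by rewrite ge_max f0 andbT leeBlDl.
Qed.

End integration.

Section iid_expectation.
Local Open Scope ereal_scope.
Context {R : realType} {d} {U : measurableType d}.

Lemma iidE_ge0 (P : {measure set U -> \bar R}) n (F : n.-tuple U -> \bar R) :
  (forall S, 0 <= F S) -> 0 <= iidE P F.
Proof.
by elim: n F => [|n IH] F F0 //=; apply: integral_ge0 => z _; exact: IH.
Qed.

Lemma le_iidE (P : {measure set U -> \bar R}) n (F F' : n.-tuple U -> \bar R) :
  (forall S, 0 <= F S) -> (forall S, F S <= F' S) -> iidE P F <= iidE P F'.
Proof.
elim: n F F' => [|n IH] F F' F0 FF' //=; apply: ge0_le_lower_integral => z.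
  exact: iidE_ge0.
exact: IH.
Qed.

Lemma iidE_cst (P : probability U R) n (c : \bar R) :
  iidE P (fun _ : n.-tuple U => c) = c.
Proof.
elim: n => //= n IH.
by under eq_integral do rewrite IH; exact: integral_cst_probability.
Qed.

(** The induction ranges over all parameter spaces: the first observation becomes part of the
    parameter, which then lives in [A * U]. *)
Lemma measurable_iidE {dA} {A : measurableType dA} n
    (k : A -> pprobability U R) (F : A * n.-tuple U -> \bar R) :
  measurable_fun setT k -> measurable_fun setT F -> (forall x, 0 <= F x) ->
  measurable_fun setT (fun a => iidE (k a : probability U R) (fun S => F (a, S))).
Proof.
elim: n dA A k F => [|n IH] dA A k F mk mF F0 /=.
  by apply: (measurableT_comp mF); exact: measurable_pair2.
apply: (@measurable_integral_pprobability _ _ _ _ _ k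
  (fun p => iidE (k p.1 : probability U R) (fun s => F (p.1, cons_tuple p.2 s)))) => //.
  apply: (IH _ _ (k \o fst)
    (fun q : (A * U) * n.-tuple U => F (q.1.1, cons_tuple q.1.2 q.2))) => //.
    exact: measurableT_comp.
  apply: (measurableT_comp mF); apply: measurable_fun_pair.
    exact: measurableT_comp.
  by apply: measurable_cons => //; exact: measurableT_comp.
by move=> p; exact: iidE_ge0.
Qed.

Lemma measurable_iidE_cons (P : probability U R) n {dA} {A : measurableType dA}
    (F : A * n.+1.-tuple U -> \bar R) :
  measurable_fun setT F -> (forall x, 0 <= F x) ->
  measurable_fun setT (fun p : A * U =>
    iidE P (fun s : n.-tuple U => F (p.1, cons_tuple p.2 s))).
Proof.
move=> mF F0.
apply: (@measurable_iidE _ _ n (fun=> P)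
   (fun q : (A * U) * n.-tuple U => F (q.1.1, cons_tuple q.1.2 q.2))) => //.
apply: (measurableT_comp mF); apply: measurable_fun_pair.
  exact: measurableT_comp.
by apply: measurable_cons => //; exact: measurableT_comp.
Qed.

Lemma measurable_cons_tuple n (z : U) :
  measurable_fun setT (fun s : n.-tuple U => cons_tuple z s).
Proof. exact: measurable_cons. Qed.

Lemma measurable_iidE_consT (P : probability U R) n
    (F : n.+1.-tuple U -> \bar R) :
  measurable_fun setT F -> (forall x, 0 <= F x) ->
  measurable_fun setT (fun z : U =>
    iidE P (fun s : n.-tuple U => F (cons_tuple z s))).
Proof.
move=> mF F0.
apply: (@measurable_iidE _ _ n (fun=> P)
   (fun q : U * n.-tuple U => F (cons_tuple q.1 q.2))) => //.
by apply: (measurableT_comp mF); exact: measurable_cons.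
Qed.

Lemma iidED (P : probability U R) n (F F' : n.-tuple U -> \bar R) :
  measurable_fun setT F -> (forall x, 0 <= F x) ->
  measurable_fun setT F' -> (forall x, 0 <= F' x) ->
  iidE P (fun S => F S + F' S) = iidE P F + iidE P F'.
Proof.
elim: n F F' => [//|n IH] F F' mF F0 mF' F'0 /=.
have mc z := measurable_cons_tuple n z.
transitivity (\int[P]_z (iidE P (fun s : n.-tuple U => F (cons_tuple z s)) +
                         iidE P (fun s : n.-tuple U => F' (cons_tuple z s)))).
  apply: eq_integral => z _; rewrite IH//; exact: measurableT_comp (mc z).
rewrite ge0_integralD// => [z _||z _|]; try exact: iidE_ge0.
  exact: measurable_iidE_consT.
exact: measurable_iidE_consT.
Qed.

Lemma iidEZl (P : probability U R) n (c : R) (F : n.-tuple U -> \bar R) :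
  (0 <= c)%R -> measurable_fun setT F -> (forall x, 0 <= F x) ->
  iidE P (fun S => c%:E * F S) = c%:E * iidE P F.
Proof.
move=> c0; elim: n F => [//|n IH] F mF F0 /=.
have mc z := measurable_cons_tuple n z.
transitivity (\int[P]_z (c%:E * iidE P (fun s : n.-tuple U => F (cons_tuple z s)))).
  apply: eq_integral => z _; rewrite IH//; exact: measurableT_comp (mc z).
rewrite ge0_integralZl_EFin// => [z _|]; first exact: iidE_ge0.
exact: measurable_iidE_consT.
Qed.

Lemma iidE_sum (P : probability U R) n {I : Type} (r : seq I)
    (F : I -> n.-tuple U -> \bar R) :
  (forall i, measurable_fun setT (F i)) -> (forall i x, 0 <= F i x) ->
  iidE P (fun S => \sum_(i <- r) F i S) = \sum_(i <- r) iidE P (F i).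
Proof.
move=> mF F0; elim: r => [|i r IH].
  by under eq_fun do rewrite big_nil; rewrite big_nil iidE_cst.
under eq_fun do rewrite big_cons; rewrite big_cons iidED ?IH//.
- exact: emeasurable_sum.
- by move=> x; exact: sume_ge0.
Qed.

(** Tonelli's theorem moves [mu] past one observation at a time. *)
Lemma iidE_tonelli (P : probability U R) n {dA} {A : measurableType dA}
    (mu : {sigma_finite_measure set A -> \bar R})
    (F : A * n.-tuple U -> \bar R) :
  measurable_fun setT F -> (forall x, 0 <= F x) ->
  \int[mu]_a iidE P (fun S => F (a, S)) = iidE P (fun S => \int[mu]_a F (a, S)).
Proof.
elim: n F => [//|n IH] F mF F0 /=.
rewrite (@fubini_tonelli _ _ _ _ _ mu P
  (fun p => iidE P (fun s : n.-tuple U => F (p.1, cons_tuple p.2 s)))).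
- apply: eq_integral => z _ /=.
  rewrite (IH (fun p => F (p.1, cons_tuple z p.2)))//.
  apply: (measurableT_comp mF); apply: measurable_fun_pair => //.
  by apply: measurable_cons.
- exact: measurable_iidE_cons.
- by move=> p; exact: iidE_ge0.
Qed.

(* The data seen before time [i] are independent of the [i]-th observation. *)
Lemma iidE_fresh (P : probability U R) n (i : 'I_n) (f : seq U -> U -> \bar R) :
  iidE P (fun S : n.-tuple U => \int[P]_z f (take i S) z) =
  iidE P (fun S : n.-tuple U => f (take i S) (tnth S i)).
Proof.
elim: n i f => [[]//|n IH] i f /=.
have [->|[j ->]] : i = ord0 \/ exists j, i = lift ord0 j.
  by case: (unliftP ord0 i) => [j|] ->; [right; exists j|left].
- transitivity (\int[P]_z f [::] z); last first.
    by apply: eq_integral => z _; rewrite -[LHS](iidE_cst P n).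
  rewrite -[RHS](integral_cst_probability P).
  by apply: eq_integral => z _; rewrite -[RHS](iidE_cst P n).
- apply: eq_integral => z _ /=.
  rewrite (IH j (fun s => f (z :: s))); congr (iidE P _); apply/funext => S.
  by congr f; rewrite tnthS.
Qed.

(** Since [f] may fail to be measurable, the sum cannot be integrated term by term. The observations
    are integrated one at a time instead, each through [ge0_integral_le_cstD]. *)
Lemma iidE_le_sum (P : probability U R) n (F : n.-tuple U -> \bar R)
    (f : U -> \bar R) (a : \bar R) :
  measurable_fun setT F -> (forall S, 0 <= F S) -> (forall z, 0 <= f z) ->
  0 <= a -> (forall S, F S <= a + \sum_(i < n) f (tnth S i)) ->
  iidE P F <= a + \sum_(i < n) \int[P]_z f z.
Proof.
move=> + + f0; elim: n F a => [|n IH] F a mF F0 a0 Fle.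
  by move: (Fle [tuple]); rewrite /= !big_ord0.
have If0 : 0 <= \int[P]_z f z by exact: integral_ge0.
rewrite big_ord_recl addeCA addeC /=.
apply: ge0_integral_le_cstD; [|move=> z|by []| |move=> z].
- exact: measurable_iidE_consT.
- exact: iidE_ge0.
- by rewrite adde_ge0 ?sume_ge0.
(* With the first observation [z] fixed, [f z] joins the constant; this is why [a] is general in the
   induction. *)
- rewrite addeAC; apply: IH => //.
  + by apply: (measurableT_comp mF); exact: measurable_cons_tuple.
  + by rewrite adde_ge0.
  + move=> S; apply: le_trans (Fle _) _; rewrite big_ord_recl addeA.
    by under eq_bigr do rewrite tnthS.
Qed.

End iid_expectation.

(** * Expectations over a random task *)

Section task_expectation.
Local Open Scope ereal_scope.
Context {R : realType} {d} {U : measurableType d}.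
Variable Q : probability (pprobability U R) R.

(** One layer of the recursion [tasksE]: the law of a sample of a fresh task is the [Q]-mixture of
    product laws. *)
Definition taskE {m} (F : m.-tuple U -> \bar R) : \bar R :=
  \int[Q]_P iidE (P : probability U R) F.

Lemma measurable_iidE_pprobability m (F : m.-tuple U -> \bar R) :
  measurable_fun setT F -> (forall S, 0 <= F S) ->
  measurable_fun setT
    (fun P : pprobability U R => iidE (P : probability U R) F).
Proof.
move=> mF F0.
apply: (@measurable_iidE _ _ _ _ _ m id (fun p => F p.2)) => //.
exact: measurableT_comp.
Qed.

Lemma taskE_ge0 m (F : m.-tuple U -> \bar R) :
  (forall S, 0 <= F S) -> 0 <= taskE F.
Proof. by move=> F0; apply: integral_ge0 => P _; exact: iidE_ge0. Qed.

Lemma le_taskE m (F F' : m.-tuple U -> \bar R) :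
  (forall S, 0 <= F S) -> (forall S, F S <= F' S) -> taskE F <= taskE F'.
Proof.
move=> F0 FF'; apply: ge0_le_lower_integral => P; first exact: iidE_ge0.
exact: le_iidE.
Qed.

Lemma taskE_cst m (c : \bar R) : taskE (fun _ : m.-tuple U => c) = c.
Proof.
rewrite -[RHS](integral_cst_probability Q).
by apply: eq_integral => P _; exact: iidE_cst.
Qed.

Lemma taskED m (F F' : m.-tuple U -> \bar R) :
  measurable_fun setT F -> (forall x, 0 <= F x) ->
  measurable_fun setT F' -> (forall x, 0 <= F' x) ->
  taskE (fun S => F S + F' S) = taskE F + taskE F'.
Proof.
move=> mF F0 mF' F'0; rewrite /taskE -ge0_integralD//.
- by apply: eq_integral => P _; exact: iidED.
- by move=> P _; exact: iidE_ge0.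
- exact: measurable_iidE_pprobability.
- by move=> P _; exact: iidE_ge0.
- exact: measurable_iidE_pprobability.
Qed.

Lemma taskEZl m (c : R) (F : m.-tuple U -> \bar R) :
  (0 <= c)%R -> measurable_fun setT F -> (forall x, 0 <= F x) ->
  taskE (fun S => c%:E * F S) = c%:E * taskE F.
Proof.
move=> c0 mF F0; rewrite /taskE -ge0_integralZl_EFin//.
- by apply: eq_integral => P _; exact: iidEZl.
- by move=> P _; exact: iidE_ge0.
- exact: measurable_iidE_pprobability.
Qed.

Lemma measurable_iidE_pair m {dA} {A : measurableType dA}
    (F : A * m.-tuple U -> \bar R) :
  measurable_fun setT F -> (forall S, 0 <= F S) ->
  measurable_fun setT (fun p : A * pprobability U R =>
    iidE (p.2 : probability U R) (fun S => F (p.1, S))).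
Proof.
move=> mF F0.
apply: (@measurable_iidE _ _ _ _ _ m snd (fun q => F (q.1.1, q.2))) => //.
apply: (measurableT_comp mF); apply: measurable_fun_pair => //.
exact: measurableT_comp.
Qed.

Lemma measurable_taskE m {dA} {A : measurableType dA}
    (F : A * m.-tuple U -> \bar R) :
  measurable_fun setT F -> (forall x, 0 <= F x) ->
  measurable_fun setT (fun a => taskE (fun S => F (a, S))).
Proof.
move=> mF F0.
apply: (@measurable_fun_fubini_tonelli_F _ _ _ _ _ Q (fun p : A * pprobability U R =>
    iidE (p.2 : probability U R) (fun S => F (p.1, S)))).
- exact: measurable_iidE_pair.
- by move=> p; exact: iidE_ge0.
Qed.

Lemma taskE_tonelli m {dA} {A : measurableType dA}
    (mu : {sigma_finite_measure set A -> \bar R})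
    (F : A * m.-tuple U -> \bar R) :
  measurable_fun setT F -> (forall x, 0 <= F x) ->
  \int[mu]_a taskE (fun S => F (a, S)) = taskE (fun S => \int[mu]_a F (a, S)).
Proof.
move=> mF F0; rewrite /taskE.
rewrite (@fubini_tonelli _ _ _ _ _ mu Q (fun p : A * pprobability U R =>
    iidE (p.2 : probability U R) (fun S => F (p.1, S)))).
- by apply: eq_integral => P _ /=; exact: iidE_tonelli.
- exact: measurable_iidE_pair.
- by move=> p; exact: iidE_ge0.
Qed.

Lemma tasksE_ge0 m T (F : seq (m.-tuple U) -> \bar R) :
  (forall D, 0 <= F D) -> 0 <= tasksE Q m T F.
Proof.
elim: T F => [|T IH] F F0 /=; first exact: F0.
by apply: taskE_ge0 => S; exact: IH.
Qed.

End task_expectation.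

(** * Hoeffding's lemma *)

Section hoeffding.
Context {R : realType}.

Lemma is_derive_ge0_le (f df : R -> R) (t : R) :
  (forall x : R, is_derive x 1 f (df x)) -> (forall x, 0 <= x -> 0 <= df x) ->
  0 <= t -> f 0 <= f t.
Proof.
move=> fdf df0 t0.
have fd x : derivable f x 1 by have [] := fdf x.
apply: (@ger0_derive1_le_cc _ f 0 t) => //.
- move=> x; rewrite in_itv/= => /andP[/ltW x0 _].
  by rewrite derive1E (@derive_val _ _ _ _ _ _ _ (fdf x)); exact: df0.
- by apply: derivable_within_continuous => x _; exact: fd.
- by rewrite in_itv/= lexx.
- by rewrite in_itv/= lexx andbT.
Qed.

(** After taking logarithms the claim is [0 <= h t], where [h] and its derivative [h'] vanish at 0
    and the second derivative of [h] is nonnegative. *)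
Lemma bernoulli_mgf_le (p t : R) : 0 <= p <= 1 -> 0 <= t ->
  1 - p + p * expR (- t) <= expR (- (p * t) + t ^+ 2 / 8).
Proof.
move=> /andP[p0 p1] t0.
pose D (x : R) : R := 1 - p + p * expR (- x).
have D_gt0 x : 0 < D x.
  rewrite /D; have [->|pn1] := eqVneq p 1.
    by rewrite subrr add0r mul1r expR_gt0.
  by rewrite ltr_wpDr ?mulr_ge0 ?expR_ge0// subr_gt0 lt_neqAle pn1.
(* The parameter of the exponentially tilted Bernoulli law; [- q] is the logarithmic derivative of
   [D]. *)
pose q (x : R) : R := p * expR (- x) / D x.
have dD (x : R) : is_derive x 1 D (- (p * expR (- x))).
  apply: is_derive_eq; rewrite /GRing.scale/=; ring.
have dq (x : R) : is_derive x 1 q (- q x + q x ^+ 2).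
  have Dx : D x != 0 by rewrite gt_eqF.
  apply: is_derive_eq; rewrite /GRing.scale/= /q; by field.
have dlnD (x : R) : is_derive x 1 (fun x => ln (D x)) (- q x).
  have := is_derive1_ln (D_gt0 x).
  move=> dl; have := @is_derive1_comp _ (@ln R) D x _ _ dl (dD x).
  by rewrite mulrN mulrC.
pose h' (x : R) : R := - p + x / 4 + q x.
have dh' (x : R) : is_derive x 1 h' (4^-1 - q x + q x ^+ 2).
  apply: is_derive_eq; rewrite /GRing.scale/=; ring.
pose h (x : R) : R := - (p * x) + x ^+ 2 / 8 - ln (D x).
have dh (x : R) : is_derive x 1 h (h' x).
  apply: is_derive_eq; rewrite /GRing.scale/= /h'; by field.
have D0 : D 0 = 1 by rewrite /D oppr0 expR0 mulr1 subrK.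
have dh_ge0 : forall y : R, 0 <= y -> 0 <= h' y.
  move=> x x0; have <- : h' 0 = 0.
    by rewrite /h' /q D0 oppr0 expR0 mul0r addr0 mulr1 divr1 addNr.
  apply: is_derive_ge0_le dh' _ x0 => y _.
  (* The variance bound [q * (1 - q) <= 1 / 4], the source of the constant 8. *)
  rewrite (_ : _ + _ = (q y - 2^-1) ^+ 2) ?sqr_ge0//; by field.
have : h 0 <= h t by exact: is_derive_ge0_le dh dh_ge0 t0.
rewrite /h D0 ln1 mulr0 oppr0 expr0n/= mul0r !addr0 subr_ge0.
by rewrite -ler_expR lnK ?posrE.
Qed.

(** By convexity the exponential lies below its chord between 0 and [C]. If [C <= 0], then [x = 0]
    and both sides are 1. *)
Lemma expR_secant_le (C x c : R) : 0 <= x <= C ->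
  expR (- (c * x)) <= 1 - x / C * (1 - expR (- (c * C))).
Proof.
move=> /andP[x0 xC]; have [C0|C0] := leP C 0.
  have -> : x = 0 by lra.
  by rewrite mulr0 oppr0 expR0 !mul0r subr0.
have tC : 0 <= x / C <= 1.
  by rewrite divr_ge0 ?(ltW C0)// ler_pdivrMr// mul1r.
have := @convex_expR _ (Itv01 (andP tC).1 (andP tC).2) (- (c * C)) 0.
rewrite !convRE/= expR0 mulr0 addr0 mulr1 /unstable.onem.
rewrite mulrN mulrCA divfK ?gt_eqF// => /le_trans; apply; lra.
Qed.


Context {d} {T : measurableType d} (mu : {measure set T -> \bar R}).
Local Open Scope ereal_scope.

(** The chord bound compares [X] with a variable taking the values 0 and [C] and having the same
    mean [x]; [bernoulli_mgf_le] then applies with [p = x / C] and [t = eta * C]. *)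
Lemma hoeffding_density (w X : T -> R) (C eta x : R) :
  measurable_fun setT w -> (forall t, 0 <= w t)%R ->
  \int[mu]_t (w t)%:E = 1 ->
  measurable_fun setT X -> (forall t, 0 <= X t <= C)%R ->
  (0 <= C)%R -> (0 <= eta)%R ->
  \int[mu]_t (X t * w t)%:E = x%:E ->
  \int[mu]_t (expR (- (eta * X t)) * w t)%:E <=
  (expR (- (eta * x) + eta ^+ 2 * C ^+ 2 / 8))%:E.
Proof.
move=> mw w0 w1 mX XC C0 eta0 intX.
have X0 t : (0 <= X t)%R by case/andP: (XC t).
have Xw0 t : (0 <= X t * w t)%R by rewrite mulr_ge0.
have x0 : (0 <= x)%R.
  by rewrite -lee_fin -intX; apply: integral_ge0 => t _; rewrite lee_fin.
have mXw : measurable_fun setT (fun t => (X t * w t)%:E).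
  by apply/measurable_EFinP; exact: measurable_funM.
have xC : (x <= C)%R.
  rewrite -lee_fin -intX -[leRHS]mule1 -w1 -ge0_integralZl_EFin//; last 2 first.
    by move=> t _; rewrite lee_fin.
    by apply/measurable_EFinP.
  apply: ge0_le_lower_integral => t; first by rewrite lee_fin.
  by rewrite -EFinM lee_fin ler_wpM2r//; case/andP: (XC t).
pose b : R := ((1 - expR (- (eta * C))) / C)%R.
have b0 : (0 <= b)%R.
  by rewrite divr_ge0// subr_ge0 -expR0 ler_expR oppr_le0 mulr_ge0.
have mexp : measurable_fun setT (fun t => (expR (- (eta * X t)) * w t)%:E).
  apply/measurable_EFinP; apply: measurable_funM => //.
  apply: measurableT_comp => //; apply: measurableT_comp => //.
  exact: measurable_funM.
have exp0 t : 0 <= (expR (- (eta * X t)) * w t)%:E.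
  by rewrite lee_fin mulr_ge0 ?expR_ge0.
(* The chord is [1 - b * X t]. Moving [b * X t] to the left keeps all integrands nonnegative. *)
have : \int[mu]_t (expR (- (eta * X t)) * w t)%:E + (b * x)%:E <= 1.
  rewrite EFinM -intX -ge0_integralZl_EFin//; last by move=> t _; rewrite lee_fin.
  rewrite -ge0_integralD//; last 2 first.
    by move=> t _; rewrite mule_ge0 ?lee_fin.
    by apply: measurable_funeM.
  rewrite -w1; apply: ge0_le_lower_integral => t.
    by rewrite adde_ge0// mule_ge0// lee_fin.
  rewrite -EFinM -EFinD lee_fin -[leRHS]mul1r mulrA -mulrDl ler_wpM2r//.
  have := @expR_secant_le C (X t) eta (XC t).
  rewrite (_ : X t / C * _ = b * X t)%R; last by rewrite /b; ring.
  by rewrite lerBrDr.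
rewrite -leeBrDr// -EFinB => /le_trans; apply; rewrite lee_fin.
have [C00|Cn0] := eqVneq C 0%R.
  have -> : x = 0%R by apply/eqP; rewrite eq_le x0 -C00 xC.
  by rewrite C00 !mulr0 expr0n/= mulr0 mul0r subr0 oppr0 addr0 expR0.
have p01 : (0 <= x / C <= 1)%R.
  by rewrite divr_ge0//= ler_pdivrMr ?mul1r// lt_neqAle eq_sym Cn0.
have := bernoulli_mgf_le _ _ p01 (mulr_ge0 eta0 C0).
rewrite (_ : 1 - x / C + x / C * _ = 1 - b * x)%R; last by rewrite /b; field.
move=> /le_trans; apply; rewrite ler_expR le_eqVlt; apply/orP; left; apply/eqP.
by field.
Qed.

End hoeffding.

(** * The Donsker-Varadhan inequality *)

Section donsker_varadhan.
Local Open Scope ereal_scope.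
Context {R : realType} {d} {G : measurableType d}.
Variables (rho pi : probability G R) (rho_pi : rho `<< pi).

(** A version of the density that is finite and nonnegative at every point; [KLE] relates it to the
    one used in [KL]. *)
Let f : G -> R := fine \o Radon_Nikodym_SigmaFinite.f rho pi.

Let fE g : Radon_Nikodym_SigmaFinite.f rho pi g = (f g)%:E.
Proof. by rewrite /f /= fineK// Radon_Nikodym_SigmaFinite.f_fin_num. Qed.

Let f_ge0 g : (0 <= f g)%R.
Proof. by rewrite -lee_fin -fE Radon_Nikodym_SigmaFinite.f_ge0. Qed.

Let measurable_f : measurable_fun setT f.
Proof.
apply: measurableT_comp => //.
exact: measurable_int (Radon_Nikodym_SigmaFinite.f_integrable rho_pi).
Qed.

Let integral_density (h : G -> R) : measurable_fun setT h ->
  (forall g, 0 <= h g)%R ->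
  \int[rho]_g (h g)%:E = \int[pi]_g (h g * f g)%:E.
Proof.
move=> mh h0; rewrite -(Radon_Nikodym_SigmaFinite.change_of_variables rho_pi)//.
- by apply: eq_integral => g _; rewrite fE EFinM.
- exact/measurable_EFinP.
Qed.

(** The [rho]-mass of the zero set of [f] is the [pi]-integral of [f] over that set. *)
Let f_gt0_ae : {ae rho, forall g, (0 < f g)%R}.
Proof.
have mA : measurable (f @^-1` [set 0%R]).
  by rewrite -[f @^-1` _]setTI; exact: measurable_f.
exists (f @^-1` [set 0%R]); split => //.
  rewrite (Radon_Nikodym_SigmaFinite.f_integral rho_pi)//.
  by rewrite integral0_eq// => g /= fg0; rewrite fE fg0.
by move=> g /= /negP; rewrite -leNgt => fg0; apply/eqP; rewrite eq_le fg0 f_ge0.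
Qed.

(** The two densities agree outside a [pi]-null set, which is [rho]-null by absolute continuity. *)
Let KLE : KL rho pi = \int[rho]_g (ln (f g))%:E.
Proof.
rewrite /KL; case: (pselect _) => [rp|nrp] /=; last by case: (nrp rho_pi).
clear rp; apply: ae_eq_integral => //.
- have rho_pi' : charge_of_finite_measure rho `<< pi := rho_pi.
  have /measurable_int mRN := Radon_Nikodym_integrable rho_pi'.
  apply/measurable_EFinP/(measurableT_comp (@measurable_ln R)).
  exact: measurableT_comp mRN.
- by apply/measurable_EFinP; exact: measurableT_comp.
- have [N [mN N0 sub]] := ae_eq_Radon_Nikodym_SigmaFinite rho_pi measurableT.
  exists N; split => //.
    by apply: (rho_pi _ ((measure0_null_setP _ mN).2 N0)).
  move=> g /= gN; apply: sub => /= eqg; apply: gN => _.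
  by rewrite -eqg// fE.
Qed.


Let measurable_invf : measurable_fun setT (fun g => (f g)^-1%R).
Proof.
rewrite (_ : (fun _ => _) = (fun g => f g `^ (-1))%R); last first.
  by apply/funext => g; rewrite powR_inv1.
exact: (measurableT_comp (measurable_powR (-1)%R) measurable_f).
Qed.

(* Where [f g = 0] we have [(f g)^-1 = 0], so this is only an inequality. *)
Let integral_inv_density (h : G -> R) : measurable_fun setT h ->
  (forall g, 0 <= h g)%R ->
  \int[rho]_g (h g / f g)%:E <= \int[pi]_g (h g)%:E.
Proof.
move=> mh h0; rewrite integral_density; last 2 first.
- by apply: measurable_funM => //; exact: measurable_invf.
- by move=> g; rewrite divr_ge0.
apply: ge0_le_lower_integral => g; first by rewrite lee_fin !mulr_ge0// invr_ge0.
rewrite lee_fin; have [->|fn0] := eqVneq (f g) 0%R; first by rewrite mulr0.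
by rewrite divfK.
Qed.

(** With [q = expR (- u) / z / f], integrating [1 + ln q <= q] against [rho] gives the claim,
    because the integral of [q] is at most 1. *)
Lemma KL_variational_ge (u : G -> R) (z : R) :
  measurable_fun setT u -> (forall g, 0 <= u g)%R ->
  \int[pi]_g (expR (- u g))%:E = z%:E -> (0 < z)%R ->
  0 <= KL rho pi + ((ln z)%:E + \int[rho]_g (u g)%:E).
Proof.
move=> mu u0 intu z0.
have mlnf : measurable_fun setT (fun g => (ln (f g))%:E).
  by apply/measurable_EFinP; exact: measurableT_comp.
have mexpu : measurable_fun setT (fun g => expR (- u g)).
  by apply: measurableT_comp => //; exact: measurableT_comp.
(* Since [- ln f <= 1 / f] and [1 / f] has [rho]-integral at most 1, only the positive part of
   [ln f] can have an infinite integral. *)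
have fin_neg : \int[rho]_g ((fun g => (ln (f g))%:E)^\- g) < +oo.
  apply: (@le_lt_trans _ _ 1); last exact: ltry.
  rewrite -[leRHS](integral_cst_probability pi).
  apply: le_trans (integral_inv_density (fun=> 1%R) _ _) => //.
  apply: ae_ge0_le_integral => //.
  - exact: measurable_funeneg.
  - by move=> g _; rewrite lee_fin div1r invr_ge0.
  - by apply/measurable_EFinP/measurable_funM => //; exact: measurable_invf.
  - apply: filterS f_gt0_ae => g fg0 _.
    rewrite funenegE -EFinN -EFin_max lee_fin ge_max div1r invr_ge0 f_ge0 andbT.
    rewrite -lnV ?posrE//; apply: ltW; apply: ln_sublinear.
    by rewrite invr_gt0.
(* This makes [1 - ln z] nonnegative, so that it may be integrated together with the other
   nonnegative terms. *)
have z1 : (z <= 1)%R.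
  rewrite -lee_fin -intu -(integral_cst_probability pi 1).
  apply: ge0_le_lower_integral => g; first by rewrite lee_fin expR_ge0.
  by rewrite lee_fin -expR0 ler_expR oppr_le0.
have lnz0 : (ln z <= 0)%R by exact: ln_le0.
pose q g : R := (expR (- u g) / z / f g)%R.
have q0 g : (0 <= q g)%R by rewrite /q !divr_ge0 ?expR_ge0// ltW.
have mq : measurable_fun setT q.
  apply: measurable_funM; first exact: measurable_funM.
  exact: measurable_invf.
have intq : \int[rho]_g (q g)%:E <= 1.
  apply: le_trans (integral_inv_density (fun g => expR (- u g) / z)%R _ _) _.
  - exact: measurable_funM.
  - by move=> g; rewrite divr_ge0 ?expR_ge0// ltW.
  - under eq_integral do rewrite EFinM muleC.
    rewrite ge0_integralZl_EFin ?invr_ge0 ?(ltW z0)//; last first.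
      exact/measurable_EFinP.
    by rewrite intu -EFinM mulVf ?gt_eqF.
(* The integrated inequality, with every negative term moved across: [KL] may be infinite, so no
   difference is formed yet. *)
have : \int[rho]_g ((fun g => (ln (f g))%:E)^\- g) + (1 - ln z)%:E <=
    \int[rho]_g ((fun g => (ln (f g))%:E)^\+ g) + (\int[rho]_g (u g)%:E + 1).
  have -> : (1 - ln z)%:E = \int[rho]_g (1 - ln z)%:E.
    by rewrite integral_cst_probability.
  apply: (@le_trans _ _ (\int[rho]_g ((fun g => (ln (f g))%:E)^\+ g) +
      (\int[rho]_g (u g)%:E + \int[rho]_g (q g)%:E))); last first.
    by rewrite leeD2l// leeD2l.
  rewrite -!ge0_integralD//.
  all: try by [exact: measurable_funepos|exact: measurable_funeneg|
    exact/measurable_EFinP].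
  all: try by [move=> g _; rewrite ?adde_ge0// lee_fin// subr_ge0 (le_trans lnz0)].
  - apply: ae_ge0_le_integral => //.
    + by move=> g _; rewrite adde_ge0// lee_fin subr_ge0 (le_trans lnz0).
    + by apply: emeasurable_funD => //; exact: measurable_funeneg.
    + by move=> g _; rewrite !adde_ge0// lee_fin.
    + apply: emeasurable_funD; first exact: measurable_funepos.
      by apply: emeasurable_funD; exact/measurable_EFinP.
    + apply: filterS f_gt0_ae => g fg0 _.
      rewrite funenegE funeposE -EFinN -!EFin_max -!EFinD lee_fin.
      have : (1 + (- u g - ln z - ln (f g)) <= q g)%R.
        rewrite /q -[X in (_ / X / _)%R](@lnK _ z) ?posrE//.
        rewrite -[X in (_ / X)%R](@lnK _ (f g)) ?posrE//.
        by rewrite -!expRN -!expRD expR_ge1Dx.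
      by case: (leP 0 (ln (f g)))%R => lnf; [rewrite max_r ?oppr_le0|
        rewrite max_l ?oppr_ge0 ?(ltW lnf)//]; lra.
  - by apply: emeasurable_funD; exact/measurable_EFinP.
rewrite KLE [in X in _ -> _ <= X + _]integralE.
have : 0 <= \int[rho]_g (u g)%:E.
  by apply: integral_ge0 => g _; rewrite lee_fin.
have : 0 <= \int[rho]_g ((fun g => (ln (f g))%:E)^\- g).
  exact: integral_ge0.
have : 0 <= \int[rho]_g ((fun g => (ln (f g))%:E)^\+ g).
  exact: integral_ge0.
move: fin_neg; move: (\int[rho]_g (_^\- g)) (\int[rho]_g (_^\+ g)).
move: (\int[rho]_g (u g)%:E) => [i| |] [a| |] [b| |]//= _ _ _ _.
by rewrite -!(EFinD, EFinB) !lee_fin; lra.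
Qed.

End donsker_varadhan.

(** * Regret of EWA *)

Section weighted_mean.
Local Open Scope ereal_scope.
Context {R : realType} {d} {G : measurableType d}.
Variables (mu : probability G R) (w : G -> R).
Hypothesis measurable_w : measurable_fun setT w.
Hypothesis w_ge0 : forall g, (0 <= w g)%R.
Hypothesis w_int : \int[mu]_g (w g)%:E = 1.

(** The mean under the law with density [w]. It serves both for the EWA distributions ([mu = pi1])
    and for [rho] ([w = 1]). *)
Definition wmean (f : G -> R) : R := fine (\int[mu]_g (f g * w g)%:E).

Lemma wmeanE (f : G -> R) (B : R) : measurable_fun setT f ->
  (forall g, 0 <= f g <= B)%R -> \int[mu]_g (f g * w g)%:E = (wmean f)%:E.
Proof.
move=> mf fB; rewrite /wmean fineK//.
have fw0 : 0 <= \int[mu]_g (f g * w g)%:E.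
  apply: integral_ge0 => g _; rewrite lee_fin mulr_ge0//.
  by case/andP: (fB g).
rewrite ge0_fin_numE//; apply: (@le_lt_trans _ _ (B%:E * 1)); last first.
  by rewrite mule1 ltry.
rewrite -w_int.
have B0 : (0 <= B)%R by have /andP[] := fB point; exact: le_trans.
rewrite -ge0_integralZl_EFin//; last 2 first.
  by move=> g _; rewrite lee_fin.
  exact/measurable_EFinP.
apply: ge0_le_lower_integral => g.
  by rewrite lee_fin mulr_ge0//; case/andP: (fB g).
by rewrite -EFinM lee_fin ler_wpM2r//; case/andP: (fB g).
Qed.

Lemma wmean_ge0 (f : G -> R) : (forall g, 0 <= f g)%R -> (0 <= wmean f)%R.
Proof.
move=> f0; apply: fine_ge0; apply: integral_ge0 => g _.
by rewrite lee_fin mulr_ge0.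
Qed.

Lemma wmeanD (f f' : G -> R) (B B' : R) :
  measurable_fun setT f -> (forall g, 0 <= f g <= B)%R ->
  measurable_fun setT f' -> (forall g, 0 <= f' g <= B')%R ->
  wmean (fun g => f g + f' g)%R = (wmean f + wmean f')%R.
Proof.
move=> mf fB mf' fB'; apply: EFin_inj.
rewrite EFinD -(wmeanE _ _ mf fB) -(wmeanE _ _ mf' fB').
rewrite -(@wmeanE _ (B + B'))//; last 2 first.
- exact: measurable_funD.
- move=> g; have /andP[f0 fB1] := fB g; have /andP[f'0 fB'1] := fB' g.
  by rewrite addr_ge0// lerD.
rewrite -ge0_integralD//.
- by apply: eq_integral => g _; rewrite -EFinD mulrDl.
- by move=> g _; rewrite lee_fin mulr_ge0//; case/andP: (fB g).
- by apply/measurable_EFinP; exact: measurable_funM.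
- by move=> g _; rewrite lee_fin mulr_ge0//; case/andP: (fB' g).
- by apply/measurable_EFinP; exact: measurable_funM.
Qed.

Context {dU} {U : measurableType dU} (Q : probability (pprobability U R) R).
Variables (m : nat) (L : G -> m.-tuple U -> R) (C : R).
Hypothesis measurable_L :
  measurable_fun setT (fun p : G * m.-tuple U => L p.1 p.2).
Hypothesis L_bnd : forall g S, (0 <= L g S <= C)%R.

Let measurable_Ll g : measurable_fun setT (L g).
Proof. exact: (measurableT_comp measurable_L (measurable_pair1 g)). Qed.

Let measurable_Lr S : measurable_fun setT (L ^~ S).
Proof. exact: (measurableT_comp measurable_L (measurable_pair2 S)). Qed.

Let measurable_Lw :
  measurable_fun setT (fun p : G * m.-tuple U => (L p.1 p.2 * w p.1)%:E).
Proof.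
apply/measurable_EFinP; apply: measurable_funM => //.
exact: measurableT_comp.
Qed.

Let Lw_ge0 (p : G * m.-tuple U) : 0 <= (L p.1 p.2 * w p.1)%:E.
Proof. by rewrite lee_fin mulr_ge0//; case/andP: (L_bnd p.1 p.2). Qed.

Lemma measurable_wmean : measurable_fun setT (fun S => wmean (L ^~ S)).
Proof.
apply/measurable_EFinP.
rewrite (_ : _ \o _ = fun S => \int[mu]_g (L g S * w g)%:E); last first.
  by apply/funext => S /=; rewrite (@wmeanE _ C).
exact: (@measurable_fun_fubini_tonelli_G _ _ _ _ _ mu
  (fun p => (L p.1 p.2 * w p.1)%:E)).
Qed.

(** The function V of the overview, as a real number; it is finite because [L] is bounded. *)
Definition risk (g : G) : R := fine (taskE Q (fun S => (L g S)%:E)).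

Lemma riskE g : taskE Q (fun S => (L g S)%:E) = (risk g)%:E.
Proof.
rewrite /risk fineK// ge0_fin_numE; last first.
  by apply: taskE_ge0 => S; rewrite lee_fin; case/andP: (L_bnd g S).
apply: (@le_lt_trans _ _ C%:E); last exact: ltry.
rewrite -(taskE_cst Q m C%:E); apply: le_taskE => S;
  by rewrite lee_fin; case/andP: (L_bnd g S).
Qed.

Lemma risk_bnd g : (0 <= risk g <= C)%R.
Proof.
rewrite -2!lee_fin -riskE; apply/andP; split.
  by apply: taskE_ge0 => S; rewrite lee_fin; case/andP: (L_bnd g S).
rewrite -(taskE_cst Q m C%:E); apply: le_taskE => S;
  by rewrite lee_fin; case/andP: (L_bnd g S).
Qed.

Lemma measurable_risk : measurable_fun setT risk.
Proof.
apply/measurable_EFinP.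
rewrite (_ : _ \o _ = fun g => taskE Q (fun S => (L g S)%:E)); last first.
  by apply/funext => g /=; rewrite riskE.
apply: (@measurable_taskE _ _ _ Q m _ _ (fun p => (L p.1 p.2)%:E)).
  exact/measurable_EFinP.
by move=> p; rewrite lee_fin; case/andP: (L_bnd p.1 p.2).
Qed.

(** The weight [w] does not involve the fresh sample [S], so Tonelli exchanges the two means. This
    is where independence of the new task from the past enters. *)
Lemma taskE_wmean :
  taskE Q (fun S => (wmean (L ^~ S))%:E) = (wmean risk)%:E.
Proof.
transitivity (taskE Q (fun S => \int[mu]_g (L g S * w g)%:E)).
  by congr taskE; apply/funext => S; rewrite (@wmeanE _ C).
rewrite -(@wmeanE _ C measurable_risk risk_bnd).
rewrite -(@taskE_tonelli _ _ _ Q m _ _ mu _ measurable_Lw Lw_ge0).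
apply: eq_integral => g _ /=.
rewrite EFinM -riskE muleC -taskEZl//.
- by congr taskE; apply/funext => S; rewrite -EFinM mulrC.
- exact/measurable_EFinP.
- by move=> S; rewrite lee_fin; case/andP: (L_bnd g S).
Qed.

End weighted_mean.

(** * Density of the EWA distributions and the potential argument *)

Section ewa.
Local Open Scope ereal_scope.
Context {R : realType} {dX dY dG : measure_display} {X : measurableType dX}
  {Y : measurableType dY} {G : measurableType dG}.
Local Notation U := (X * Y)%type.
Variables (Q : probability (pprobability U R) R) (pi1 : probability G R).
Variables (m : nat) (L : G -> m.-tuple U -> R) (C eta : R).
Hypothesis measurable_L :
  measurable_fun setT (fun p : G * m.-tuple U => L p.1 p.2).
Hypothesis L_bnd : forall g S, (0 <= L g S <= C)%R.
Hypothesis eta_gt0 : (0 < eta)%R.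

Let C_ge0 : (0 <= C)%R.
Proof. by have /andP[] := L_bnd point point; exact: le_trans. Qed.

Let measurable_Lr S : measurable_fun setT (L ^~ S).
Proof. exact: (measurableT_comp measurable_L (measurable_pair2 S)). Qed.

Definition cumloss (D : seq (m.-tuple U)) (g : G) : R :=
  (\sum_(S <- D) L g S)%R.

Definition ewa_weight D g : R := expR (- (eta * cumloss D g)).

Definition partition_fun D : R := fine (\int[pi1]_g (ewa_weight D g)%:E).

Definition ewa_density D g : R := (ewa_weight D g / partition_fun D)%R.

Lemma measurable_cumloss D : measurable_fun setT (cumloss D).
Proof. by apply: measurable_sum => S; exact: measurable_Lr. Qed.

Lemma cumloss_bnd D g : (0 <= cumloss D g <= (size D)%:R * C)%R.
Proof.
rewrite /cumloss; elim: D => [|S D /andP[IH1 IH2]].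
  by rewrite big_nil mul0r lexx.
have /andP[L0 LC] := L_bnd g S.
by rewrite big_cons addr_ge0//= -natr1 mulrDl mul1r addrC lerD.
Qed.

Lemma measurable_ewa_weight D : measurable_fun setT (ewa_weight D).
Proof.
apply: measurableT_comp => //; apply: measurableT_comp => //.
by apply: measurable_funM => //; exact: measurable_cumloss.
Qed.

Lemma ewa_weight_gt0 D g : (0 < ewa_weight D g)%R.
Proof. exact: expR_gt0. Qed.

Lemma ewa_weight_le1 D g : (ewa_weight D g <= 1)%R.
Proof.
rewrite -expR0 ler_expR oppr_le0 mulr_ge0 ?(ltW eta_gt0)//.
by case/andP: (cumloss_bnd D g).
Qed.

Lemma partition_funE D :
  \int[pi1]_g (ewa_weight D g)%:E = (partition_fun D)%:E.
Proof.
rewrite /partition_fun fineK// ge0_fin_numE; last first.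
  by apply: integral_ge0 => g _; rewrite lee_fin ltW// ewa_weight_gt0.
apply: (@le_lt_trans _ _ 1); last exact: ltry.
rewrite -[leRHS](integral_cst_probability pi1).
apply: ge0_le_lower_integral => g; rewrite lee_fin ?ewa_weight_le1//.
exact/ltW/ewa_weight_gt0.
Qed.

Lemma partition_fun_gt0 D : (0 < partition_fun D)%R.
Proof.
rewrite -lte_fin -partition_funE.
(* A uniform lower bound on the weights, as each past loss is at most [C]. *)
apply: (@lt_le_trans _ _ (expR (- (eta * ((size D)%:R * C))))%:E).
  by rewrite lte_fin expR_gt0.
rewrite -[leLHS](integral_cst_probability pi1).
apply: ge0_le_lower_integral => g; rewrite lee_fin ?expR_ge0//.
rewrite ler_expR lerN2 ler_wpM2l ?(ltW eta_gt0)//.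
by case/andP: (cumloss_bnd D g).
Qed.

Lemma partition_fun_nil : partition_fun [::] = 1%R.
Proof.
rewrite /partition_fun -[RHS]/(fine 1%:E) -(integral_cst_probability pi1 1).
congr fine; apply: eq_integral => g _.
by rewrite /ewa_weight /cumloss big_nil mulr0 oppr0 expR0.
Qed.

Lemma ewa_density_ge0 D g : (0 <= ewa_density D g)%R.
Proof. by rewrite divr_ge0// ltW ?ewa_weight_gt0 ?partition_fun_gt0. Qed.

Lemma measurable_ewa_density D : measurable_fun setT (ewa_density D).
Proof. by apply: measurable_funM => //; exact: measurable_ewa_weight. Qed.

Lemma ewa_weight_rcons D S g :
  ewa_weight (rcons D S) g = (expR (- (eta * L g S)) * ewa_weight D g)%R.
Proof.
rewrite /ewa_weight /cumloss -expRD big_rcons/=; congr expR.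
by rewrite mulrDr opprD addrC.
Qed.

Lemma integral_ewa_density D :
  \int[pi1]_g (ewa_density D g)%:E = 1.
Proof.
under eq_integral do rewrite EFinM muleC.
rewrite ge0_integralZl_EFin ?invr_ge0 ?(ltW (partition_fun_gt0 _))//; last 2 first.
- by move=> g _; rewrite lee_fin ltW// ewa_weight_gt0.
- by apply/measurable_EFinP; exact: measurable_ewa_weight.
by rewrite partition_funE -EFinM mulVf// gt_eqF// partition_fun_gt0.
Qed.

(** The Laplace transform of the next loss under the current EWA law is a ratio of partition
    functions. It serves as the normaliser of the update and as the increment of the potential. *)
Lemma integral_ewa_density_rcons D S :
  \int[pi1]_g (expR (- (eta * L g S)) * ewa_density D g)%:E =
  (partition_fun (rcons D S) / partition_fun D)%:E.
Proof.
rewrite [in RHS]mulrC EFinM -partition_funE -ge0_integralZl_EFin//; last 3 first.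
- by move=> g _; rewrite lee_fin ltW// ewa_weight_gt0.
- by apply/measurable_EFinP; exact: measurable_ewa_weight.
- by rewrite invr_ge0 ltW// partition_fun_gt0.
apply: eq_integral => g _; rewrite -EFinM ewa_weight_rcons /ewa_density.
by congr EFin; ring.
Qed.

(** The successive normalisers are ratios of consecutive partition functions, so their product
    telescopes. The induction adds tasks at the end, following the reversed list in [ewaE]. *)
Lemma ewaE_density D (f : G -> \bar R) :
  measurable_fun setT f -> (forall g, 0 <= f g) ->
  ewaE pi1 eta L D f = \int[pi1]_g (f g * (ewa_density D g)%:E).
Proof.
elim/last_ind: D f => [|D S IH] f mf f0; rewrite /ewaE.
  apply: eq_integral => g _.
  rewrite /ewa_density /ewa_weight partition_fun_nil divr1 /cumloss big_nil.
  by rewrite mulr0 oppr0 expR0 mule1.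
have mexp : measurable_fun setT (fun g => (expR (- (eta * L g S)))%:E).
  apply/measurable_EFinP; apply: measurableT_comp => //.
  by apply: measurableT_comp => //; exact: measurable_funM.
have exp0 g : 0 <= (expR (- (eta * L g S)))%:E by rewrite lee_fin expR_ge0.
rewrite rev_rcons /= -!/(ewaE _ _ _ _ _) !IH//; last 2 first.
- exact: emeasurable_funM.
- by move=> g; rewrite mule_ge0.
under [X in _ * X^-1]eq_integral do rewrite -EFinM.
rewrite integral_ewa_density_rcons inver gt_eqF ?divr_gt0 ?partition_fun_gt0//.
rewrite muleC -ge0_integralZl_EFin//.
- apply: eq_integral => g _; rewrite /ewa_density ewa_weight_rcons invf_div.
  rewrite -muleA -EFinM muleCA -EFinM; congr (_ * _%:E).
  by field; rewrite !gt_eqF ?partition_fun_gt0.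
- by move=> g _; rewrite !mule_ge0// lee_fin ewa_density_ge0.
- apply: emeasurable_funM; first exact: emeasurable_funM.
  by apply/measurable_EFinP; exact: measurable_ewa_density.
- by rewrite invr_ge0 divr_ge0// ltW// partition_fun_gt0.
Qed.


Variable rho : probability G R.
Hypothesis rho_pi1 : rho `<< pi1.

Let one_int : \int[rho]_g (cst 1%R g)%:E = 1.
Proof. exact: (integral_cst_probability rho 1). Qed.

Let L_ge0 g S : (0 <= L g S)%R. Proof. by case/andP: (L_bnd g S). Qed.

Local Notation rmean := (wmean rho (cst 1%R)).

Lemma rmeanE (f : G -> R) (B : R) : measurable_fun setT f ->
  (forall g, 0 <= f g <= B)%R -> \int[rho]_g (f g)%:E = (rmean f)%:E.
Proof.
move=> mf fB; rewrite -(@wmeanE _ _ _ rho (cst 1%R) _ _ one_int _ B)//.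
by apply: eq_integral => g _; rewrite mulr1.
Qed.

(* [k] stands for the Kullback-Leibler divergence. *)
Definition potential (k : R) D : R :=
  (k + ln (partition_fun D) + eta * rmean (cumloss D))%R.

(** Donsker-Varadhan with [u] equal to [eta] times the cumulated loss and [z] the partition
    function. *)
Lemma potential_ge0 k D : KL rho pi1 = k%:E -> (0 <= potential k D)%R.
Proof.
move=> KLk; rewrite -lee_fin /potential -addrA 2!EFinD -KLk.
have mu : measurable_fun setT (fun g => eta * cumloss D g)%R.
  by apply: measurable_funM => //; exact: measurable_cumloss.
have cum0 g : (0 <= cumloss D g)%R by case/andP: (cumloss_bnd D g).
rewrite EFinM -(rmeanE (cumloss D) _ (measurable_cumloss D) (cumloss_bnd D)).
rewrite -ge0_integralZl_EFin ?(ltW eta_gt0)//; last 2 first.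
- by move=> g _; rewrite lee_fin.
- by apply/measurable_EFinP; exact: measurable_cumloss.
apply: (KL_variational_ge rho pi1 rho_pi1 (fun g => eta * cumloss D g)%R) => //.
- by move=> g; rewrite mulr_ge0 ?(ltW eta_gt0).
- exact: partition_funE.
- exact: partition_fun_gt0.
Qed.

(** The [rho]-term grows by exactly [eta] times the new mean loss; the growth of the log-partition
    function is bounded by Hoeffding's lemma under the current EWA law. *)
Lemma potential_rcons k D S :
  (potential k (rcons D S) <= potential k D +
    eta * (rmean (L ^~ S) - wmean pi1 (ewa_density D) (L ^~ S) + eta * C ^+ 2 / 8))%R.
Proof.
have eta_ge0 := ltW eta_gt0.
have cumS : cumloss (rcons D S) = (fun g => cumloss D g + L g S)%R.
  by apply/funext => g; rewrite /cumloss big_rcons.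
rewrite /potential cumS (@wmeanD _ _ _ rho (cst 1%R) _ _ one_int _ _
  ((size D)%:R * C) C)//; last 2 first.
- exact: measurable_cumloss.
- exact: cumloss_bnd.
have Z0 := partition_fun_gt0 D; have Z1 := partition_fun_gt0 (rcons D S).
have := @hoeffding_density R _ _ pi1 (ewa_density D) (L ^~ S) C eta
  (wmean pi1 (ewa_density D) (L ^~ S)) (measurable_ewa_density D)
  (ewa_density_ge0 D) (integral_ewa_density D) (measurable_Lr S) (L_bnd ^~ S)
  C_ge0 eta_ge0.
rewrite integral_ewa_density_rcons lee_fin.
rewrite (@wmeanE _ _ _ pi1 _ _ _ (integral_ewa_density D) _ C)//; last 2 first.
- exact: measurable_ewa_density.
- exact: ewa_density_ge0.
move=> /(_ erefl); rewrite -[X in (X <= _)%R]lnK ?posrE ?divr_gt0//.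
rewrite ler_expR ln_div ?posrE//.
set x := wmean pi1 _ _; set a := rmean _; set b := rmean _.
set z := ln _; set z' := ln _ => zz'.
rewrite (_ : (eta * (b - x + eta * C ^+ 2 / 8) =
  eta * b - eta * x + eta ^+ 2 * C ^+ 2 / 8)%R); last by field.
rewrite mulrDr; lra.
Qed.

Local Notation v := (risk Q m L).
Local Notation K := (rmean v + eta * C ^+ 2 / 8)%R.

(** Form suited to induction on the tasks left: [D] is the past, [c] collects the EWA risks already
    fixed by it, and [a] will be [1 / T]. *)
Lemma tasksE_ewa_le k n D (c a : R) : KL rho pi1 = k%:E ->
  (0 <= c)%R -> (0 <= a)%R ->
  tasksE Q m n (fun D' =>
    c%:E + a%:E * \sum_(t < n) ewaE pi1 eta L (D ++ take t D') (EFin \o v)) <=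
  (c + a * (n%:R * K + potential k D / eta))%:E.
Proof.
move=> KLk; have eta_ge0 := ltW eta_gt0.
have v_bnd := risk_bnd Q m L C L_bnd.
have mv := measurable_risk Q m L C measurable_L L_bnd.
have evE D' : ewaE pi1 eta L D' (EFin \o v) =
    (wmean pi1 (ewa_density D') v)%:E.
  rewrite ewaE_density//; last 2 first.
  - exact/measurable_EFinP.
  - by move=> g; rewrite lee_fin; case/andP: (v_bnd g).
  rewrite -(@wmeanE _ _ _ pi1 _ _ _ (integral_ewa_density D') _ C)//.
  - exact: measurable_ewa_density.
  - exact: ewa_density_ge0.
have ev0 D' : 0 <= ewaE pi1 eta L D' (EFin \o v).
  rewrite evE lee_fin wmean_ge0//; first exact: ewa_density_ge0.
  by move=> g; case/andP: (v_bnd g).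
have K0 : (0 <= K)%R.
  rewrite addr_ge0 ?divr_ge0 ?mulr_ge0 ?sqr_ge0// wmean_ge0// => g.
  by case/andP: (v_bnd g).
elim: n D c => [|n IH] D c c0 a0.
  rewrite /= big_ord0 mule0 adde0 lee_fin mul0r add0r lerDl mulr_ge0//.
  by rewrite divr_ge0// potential_ge0.
(* The summand at [t = 0] depends on [D] only, hence passes into the constant before the next task
   is drawn. *)
pose c' := (c + a * wmean pi1 (ewa_density D) v)%R.
have c'0 : (0 <= c')%R.
  by rewrite addr_ge0// mulr_ge0// -lee_fin -evE.
pose A := (c' + a * (n%:R * K + potential k D / eta + eta * C ^+ 2 / 8))%R.
pose B S := (A + a * rmean (L ^~ S) - a * wmean pi1 (ewa_density D) (L ^~ S))%R.
have A0 : (0 <= A)%R.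
  apply: addr_ge0 => //; apply: mulr_ge0 => //; apply: addr_ge0; last first.
    by rewrite divr_ge0// mulr_ge0// sqr_ge0.
  apply: addr_ge0; first exact: mulr_ge0.
  by rewrite divr_ge0// potential_ge0.
have F0 S : 0 <= tasksE Q m n (fun D' =>
    c%:E + a%:E * \sum_(t < n.+1) ewaE pi1 eta L (D ++ take t (S :: D')) (EFin \o v)).
  apply: tasksE_ge0 => D'; rewrite adde_ge0 ?lee_fin// mule_ge0 ?lee_fin//.
  exact: sume_ge0.
have FB S : tasksE Q m n (fun D' =>
    c%:E + a%:E * \sum_(t < n.+1) ewaE pi1 eta L (D ++ take t (S :: D')) (EFin \o v))
    <= (B S)%:E.
  have := IH (rcons D S) c' c'0 a0.
  rewrite (_ : (fun D' => _) = (fun D' => c%:E + a%:E * \sum_(t < n.+1)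
      ewaE pi1 eta L (D ++ take t (S :: D')) (EFin \o v))); last first.
    apply/funext => D'; rewrite big_ord_recl/= cats0 evE.
    rewrite ge0_muleDr ?lee_fin//; last 2 first.
    - by rewrite -lee_fin -evE.
    - exact: sume_ge0.
    rewrite addeA -EFinM -EFinD; congr (_ + _ * _).
    by apply: eq_bigr => t _; rewrite cat_rcons.
  move=> /le_trans; apply; rewrite lee_fin.
  rewrite (_ : B S = c' + a * (n%:R * K + (potential k D + eta *
    (rmean (L ^~ S) - wmean pi1 (ewa_density D) (L ^~ S) + eta * C ^+ 2 / 8)) / eta))%R.
    rewrite lerD2l ler_wpM2l// lerD2l; apply: ler_wpM2r; first by rewrite invr_ge0.
    exact: potential_rcons.
  rewrite /B /A; field.
  by rewrite gt_eqF.
have measurable_x : measurable_fun setT (fun S => wmean pi1 (ewa_density D) (L ^~ S)).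
  apply: (measurable_wmean _ _ _ _ _ _ _ C) => //.
  - exact: measurable_ewa_density.
  - exact: ewa_density_ge0.
  - exact: integral_ewa_density.
have measurable_r : measurable_fun setT (fun S => rmean (L ^~ S)).
  exact: (measurable_wmean _ _ _ _ _ _ _ C).
have x0 S : (0 <= wmean pi1 (ewa_density D) (L ^~ S))%R.
  by apply: wmean_ge0 => //; exact: ewa_density_ge0.
have r0 S : (0 <= rmean (L ^~ S))%R by exact: wmean_ge0.
(* Averaging over [S] turns both means of [L ^~ S] into means of the risk. The subtracted one is
   kept on the left, so that only nonnegative functions are integrated. *)
have EB : taskE Q (fun S => (B S)%:E) + a%:E * (wmean pi1 (ewa_density D) v)%:E =
    A%:E + a%:E * (rmean v)%:E.
  have B0 S : (0 <= B S)%R by rewrite -lee_fin; exact: le_trans (F0 S) (FB S).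
  have mr : measurable_fun setT (fun S => (rmean (L ^~ S))%:E).
    exact/measurable_EFinP.
  have mx : measurable_fun setT (fun S => (wmean pi1 (ewa_density D) (L ^~ S))%:E).
    exact/measurable_EFinP.
  rewrite -(@taskE_wmean _ _ _ pi1 _ _ _ (integral_ewa_density D) _ _ Q m L C)//;
    last 2 first.
  - exact: measurable_ewa_density.
  - exact: ewa_density_ge0.
  rewrite -(@taskE_wmean _ _ _ rho (cst 1%R) _ _ one_int _ _ Q m L C)//.
  rewrite -2?taskEZl//.
  rewrite -(taskE_cst Q m A%:E) -2?taskED//.
  - congr taskE; apply/funext => S; rewrite -!EFinM -!EFinD; congr EFin.
    by rewrite /B subrK.
  - exact: measurable_funeM.
  - by move=> S; rewrite mule_ge0 ?lee_fin.
  - apply/measurable_EFinP; apply: measurable_funB; last exact: measurable_funM.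
    by apply: measurable_funD => //; exact: measurable_funM.
  - exact: measurable_funeM.
  - by move=> S; rewrite mule_ge0 ?lee_fin.
apply: (@le_trans _ _ (taskE Q (fun S => (B S)%:E))).
  exact: le_taskE.
rewrite -(@leeD2rE _ (a%:E * (wmean pi1 (ewa_density D) v)%:E))// EB.
rewrite -!EFinM -!EFinD lee_fin le_eqVlt; apply/orP; left; apply/eqP.
rewrite /A /c' -natr1; field.
by rewrite gt_eqF.
Qed.

End ewa.

(** * From within-task regret to risk *)

Section lifelong.
Local Open Scope ereal_scope.
Context {R : realType} {dX dY dG : measure_display} {X : measurableType dX}
  {Y : measurableType dY} {Z : Type} {G : measurableType dG}.
Variables (app : G -> X -> Z) (Hs : set (Z -> R)) (l : R -> Y -> R)
  (alg : G -> seq (X * Y) -> Z -> R) (m : nat).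
Hypothesis m_gt0 : (0 < m)%N.
Hypothesis l_ge0 : forall r y, (0 <= l r y)%R.
Hypothesis measurable_avg_loss :
  measurable_fun setT (fun p : G * m.-tuple (X * Y) => avg_loss l app alg p.1 p.2).

Let measurable_avg g :
  measurable_fun setT (fun S : m.-tuple (X * Y) => avg_loss l app alg g S).
Proof. exact: (measurableT_comp measurable_avg_loss (measurable_pair1 g)). Qed.

Let avg_ge0 g (S : m.-tuple (X * Y)) : (0 <= avg_loss l app alg g S)%R.
Proof. by rewrite mulr_ge0 ?invr_ge0//; exact: sumr_ge0. Qed.

(** Counting from 0, hypothesis [i] uses the pairs before index [i], so the pair at index [i] is as
    good as a fresh test pair. *)
Lemma online_to_batch (P : probability (X * Y)%type R) g :
  (forall i : nat, measurable_fun setT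
      (fun p : (G * m.-tuple (X * Y)) * (X * Y) =>
        l (alg p.1.1 (take i p.1.2) (app p.1.1 p.2.1)) p.2.2)) ->
  iidE P (fun S : m.-tuple (X * Y) => (m%:R^-1)%:E *
    \sum_(i < m) \int[P]_z (l (alg g (take i S) (app g z.1)) z.2)%:E) =
  iidE P (fun S : m.-tuple (X * Y) => (avg_loss l app alg g S)%:E).
Proof.
move=> ml.
pose q (s : seq (X * Y)) (z : X * Y) : \bar R := (l (alg g s (app g z.1)) z.2)%:E.
have q0 s z : 0 <= q s z by rewrite lee_fin.
have mq (i : nat) : measurable_fun setT
    (fun p : m.-tuple (X * Y) * (X * Y) => q (take i p.1) p.2).
  apply/measurable_EFinP.
  apply: (measurableT_comp (ml i) (g := fun p => ((g, p.1), p.2))).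
  by apply: measurable_fun_pair => //; exact: measurable_fun_pair.
have m0 : (0 <= m%:R^-1 :> R)%R by rewrite invr_ge0.
have mI (i : 'I_m) : measurable_fun setT
    (fun S : m.-tuple (X * Y) => \int[P]_z q (take i S) z).
  exact: (@measurable_fun_fubini_tonelli_F _ _ _ _ _ P
    (fun p : m.-tuple (X * Y) * (X * Y) => q (take i p.1) p.2)).
have mt (i : 'I_m) : measurable_fun setT
    (fun S : m.-tuple (X * Y) => q (take i S) (tnth S i)).
  apply: (measurableT_comp (mq i) (g := fun S => (S, tnth S i))).
  by apply: measurable_fun_pair => //; exact: measurable_tnth.
have I0 (i : 'I_m) (S : m.-tuple (X * Y)) : 0 <= \int[P]_z q (take i S) z.
  exact: integral_ge0.
rewrite (iidEZl P m (m%:R^-1)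
  (fun S => \sum_(i < m) \int[P]_z q (take i S) z))//; last 2 first.
- exact: emeasurable_sum.
- by move=> S; exact: sume_ge0.
rewrite (iidE_sum P m _ (fun (i : 'I_m) S => \int[P]_z q (take i S) z))//.
under eq_bigr do rewrite (iidE_fresh P m _ q).
rewrite -(iidE_sum P m _ (fun (i : 'I_m) S => q (take i S) (tnth S i)))//.
rewrite -iidEZl//; last 2 first.
- exact: emeasurable_sum.
- by move=> S; exact: sume_ge0.
by congr iidE; apply/funext => S; rewrite /avg_loss EFinM -sumEFin.
Qed.

(** For each fixed [h] the regret bound is integrated over the sample. The loss of a single [h] is
    not assumed measurable, hence the use of [iidE_le_sum]. *)
Lemma iidE_avg_loss_le (P : probability (X * Y)%type R) g (b : R) :
  (forall S : m.-tuple (X * Y), (avg_loss l app alg g S)%:E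
    - ereal_inf [set (emp_loss l app h g S)%:E | h in Hs] <= b%:E) ->
  iidE P (fun S : m.-tuple (X * Y) => (avg_loss l app alg g S)%:E)
      + (Num.max (- b) 0)%:E <=
  ereal_inf [set \int[P]_z (l (h (app g z.1)) z.2)%:E | h in Hs]
      + (Num.max b 0)%:E.
Proof.
move=> regret; rewrite -leeBlDr//; apply: le_ereal_inf_tmp => _ [h Hh <-].
have mR0 : (0 < m%:R :> R)%R by rewrite ltr0n.
(* The regret bound [b] may be negative; its two parts go to opposite sides. *)
set bp := Num.max b 0%R; set bn := Num.max (- b)%R 0%R.
have bp0 : (0 <= bp)%R by rewrite /bp le_max lexx orbT.
have bn0 : (0 <= bn)%R by rewrite /bn le_max lexx orbT.
have bE : b = (bp - bn)%R.
  rewrite /bp /bn; case: (leP 0%R b) => b0; first by rewrite max_r ?subr0 ?oppr_le0.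
  by rewrite max_l ?oppr_ge0 ?(ltW b0)// sub0r opprK.
rewrite leeBlDr//.
pose F (S : m.-tuple (X * Y)) : \bar R := (avg_loss l app alg g S + bn)%:E.
have F0 S : 0 <= F S by rewrite lee_fin addr_ge0.
have mF : measurable_fun setT F.
  by apply/measurable_EFinP; exact: measurable_funD.
have -> : iidE P (fun S : m.-tuple (X * Y) => (avg_loss l app alg g S)%:E) + bn%:E =
    iidE P F.
  rewrite -[in LHS](iidE_cst P m bn%:E) -iidED//.
    exact/measurable_EFinP.
  by move=> S; rewrite lee_fin.
(* Multiplying by [m] turns the averages into sums over the sample. *)
rewrite addeC -(@lee_pmul2l _ m%:R%:E)// -iidEZl//.
rewrite ge0_muleDr ?lee_fin//; last by apply: integral_ge0 => z _; rewrite lee_fin.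
have -> : m%:R%:E * \int[P]_z (l (h (app g z.1)) z.2)%:E =
    \sum_(i < m) \int[P]_z (l (h (app g z.1)) z.2)%:E.
  by rewrite sumr_const card_ord mule_natl.
apply: iidE_le_sum.
- exact: measurable_funeM.
- by move=> S; rewrite mule_ge0// lee_fin ltW.
- by move=> z; rewrite lee_fin.
- by rewrite -EFinM lee_fin mulr_ge0// ltW.
move=> S; rewrite sumEFin -!EFinM -EFinD lee_fin.
have : (avg_loss l app alg g S - emp_loss l app h g S <= b)%R.
  rewrite -lee_fin; apply: le_trans (regret S); rewrite EFinB leeB//.
  by apply: ereal_inf_lbound; exists h.
have <- : (m%:R * emp_loss l app h g S =
    \sum_(i < m) l (h (app g (tnth S i).1)) (tnth S i).2)%R.
  by rewrite mulrA mulfV ?gt_eqF// mul1r.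
rewrite -(ler_pM2l mR0 (_ - _)%R) mulrBr bE !mulrDr mulrN; lra.
Qed.


Lemma risk_le (Q : probability (pprobability (X * Y)%type R) R) g (b C : R) :
  (forall g' (S : m.-tuple (X * Y)), (avg_loss l app alg g' S <= C)%R) ->
  (forall S : m.-tuple (X * Y), (avg_loss l app alg g S)%:E
    - ereal_inf [set (emp_loss l app h g S)%:E | h in Hs] <= b%:E) ->
  measurable_fun setT (fun P : pprobability (X * Y)%type R =>
    ereal_inf [set \int[(P : probability (X * Y)%type R)]_z
                      (l (h (app g z.1)) z.2)%:E | h in Hs]) ->
  (risk Q m (fun g S => avg_loss l app alg g S) g)%:E <=
  \int[Q]_P ereal_inf [set \int[(P : probability (X * Y)%type R)]_z
                      (l (h (app g z.1)) z.2)%:E | h in Hs] + b%:E.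
Proof.
move=> avgC regret minf.
have L_bnd (g' : G) (S : m.-tuple (X * Y)) : (0 <= avg_loss l app alg g' S <= C)%R by rewrite avg_ge0 avgC.
set I := fun P => _ in minf *.
have I0 P : 0 <= I P.
  apply: le_ereal_inf_tmp => _ [h _ <-].
  by apply: integral_ge0 => z _; rewrite lee_fin.
rewrite -(riskE Q m _ C L_bnd).
have b0 (c : R) : 0 <= (Num.max c 0)%:E by rewrite lee_fin le_max lexx orbT.
have mavg : measurable_fun setT (fun S : m.-tuple (X * Y) => (avg_loss l app alg g S)%:E).
  exact/measurable_EFinP.
have : taskE Q (fun S : m.-tuple (X * Y) => (avg_loss l app alg g S)%:E)
    + (Num.max (- b) 0)%:E <= \int[Q]_P I P + (Num.max b 0)%:E.
  rewrite -[X in _ + X <= _](integral_cst_probability Q).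
  rewrite -[X in _ <= _ + X](integral_cst_probability Q).
  rewrite -!ge0_integralD//.
  - apply: ge0_le_lower_integral => P.
      by rewrite adde_ge0// iidE_ge0// => S; rewrite lee_fin.
    exact: iidE_avg_loss_le.
  - by move=> P _; apply: iidE_ge0 => S; rewrite lee_fin.
  - by apply: measurable_iidE_pprobability => // S; rewrite lee_fin.
have -> : b%:E = (Num.max b 0)%:E - (Num.max (- b) 0)%:E.
  rewrite -EFinB; congr EFin; case: (leP 0%R b) => b1.
    by rewrite max_r ?subr0 ?oppr_le0.
  by rewrite max_l ?oppr_ge0 ?(ltW b1)// sub0r opprK.
by rewrite addeA -leeBrDr.
Qed.

End lifelong.

(** Donsker-Varadhan with [u = 0] and [z = 1]; without absolute continuity the value is [+oo]. *)
Lemma KL_ge0 {R : realType} {d} {G : measurableType d} (rho pi : probability G R) :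
  (0 <= KL rho pi)%E.
Proof.
have [rho_pi|nrho_pi] := pselect (rho `<< pi); last first.
  by rewrite /KL; case: (pselect _) => //= _; rewrite leey.
have := KL_variational_ge rho pi rho_pi (cst 0) 1 (measurable_cst _)
  (fun=> lexx _).
rewrite ln1 integral0 adde0 adde0; apply => //.
rewrite -[RHS](integral_cst_probability pi).
by apply: eq_integral => g _; rewrite oppr0 expR0.
Qed.

Theorem theorem5 (R : realType) (dX dY dG : measure_display)
  (X : measurableType dX) (Y : measurableType dY) (Z : Type)
  (G : measurableType dG) (app : G -> X -> Z) (Hs : set (Z -> R))
  (l : R -> Y -> R) (alg : G -> seq (X * Y)%type -> Z -> R)
  (m T : nat) (C : R) (beta : G -> nat -> R)
  (Q : probability (pprobability (X * Y)%type R) R) (pi1 : probability G R)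
  (eta : R) :
  (0 < m)%N -> (0 < T)%N -> 0 < eta ->
  (* l is a loss: nonnegative *)
  (forall (r : R) (y : Y), 0 <= l r y) ->
  (* assumptions on the within-task algorithm *)
  (forall (g : G) (S : m.-tuple (X * Y)%type),
      0 <= avg_loss l app alg g S <= C) ->
  (forall (g : G) (S : m.-tuple (X * Y)%type),
      ((avg_loss l app alg g S)%:E
       - ereal_inf [set (emp_loss l app h g S)%:E | h in Hs]
       <= (beta g m)%:E)%E) ->
  (* measurability of the maps involved *)
  (forall i : nat, measurable_fun [set: ((G * m.-tuple (X * Y)) * (X * Y))%type]
      (fun p : ((G * m.-tuple (X * Y)) * (X * Y))%type => l (alg p.1.1 (take i p.1.2) (app p.1.1 p.2.1)) p.2.2)) ->
  measurable_fun [set: (G * m.-tuple (X * Y))%type]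
      (fun p : (G * m.-tuple (X * Y))%type => avg_loss l app alg p.1 p.2) ->
  measurable_fun [set: G] (fun g => beta g m) ->
  measurable_fun [set: (G * pprobability (X * Y) R)%type]
      (fun p : (G * pprobability (X * Y) R)%type =>
         ereal_inf [set (\int[(p.2 : probability (X * Y)%type R)]_z
                           (l (h (app p.1 z.1)) z.2)%:E)%E | h in Hs] : \bar R) ->
  (* expected loss of the whole strategy *)
  (tasksE Q m T (fun D : seq (m.-tuple (X * Y)%type) =>
     (T%:R^-1)%:E *
     \sum_(t < T)
       ewaE pi1 eta (fun (g : G) (S : m.-tuple (X * Y)%type) => avg_loss l app alg g S)
         (take t D)
         (fun g : G =>
            \int[Q]_P iidE (P : probability (X * Y)%type R)
              (fun S : m.-tuple (X * Y)%type =>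
                 (m%:R^-1)%:E *
                 \sum_(i < m) \int[(P : probability (X * Y)%type R)]_z
                                (l (alg g (take i S) (app g z.1)) z.2)%:E)))
   <=
   ereal_inf [set
     (\int[rho]_g (\int[Q]_P ereal_inf
                     [set \int[(P : probability (X * Y)%type R)]_z (l (h (app g z.1)) z.2)%:E
                     | h in Hs]
                   + (beta g m)%:E)
      + (eta * C ^+ 2 / 8)%:E
      + KL rho pi1 * ((eta * T%:R)^-1)%:E)
     | rho in [set: probability G R]])%E.
Proof.
move=> m0 T0 eta0 l0 avgC regret ml mavg mbeta minf.
apply: le_ereal_inf_tmp => _ [rho _ <-].
pose L (g : G) (S : m.-tuple (X * Y)) := avg_loss l app alg g S.
pose v := risk Q m L.
have r0 : 0 < (eta * T%:R)^-1 by rewrite invr_gt0 mulr_gt0// ltr0n.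
have v_bnd : forall g, 0 <= v g <= C := risk_bnd Q m L C avgC.
have mv : measurable_fun setT v := measurable_risk Q m L C mavg avgC.
(* The expected test loss of the randomly drawn hypothesis on a new task, identified with the risk
   [v] by [online_to_batch]. *)
set W := (fun g : G => integral _ _ _).
have {W} -> : W = EFin \o v.
  apply/funext => g /=; rewrite -(riskE Q m L C avgC) /W.
  by apply: eq_integral => P _; exact: online_to_batch.
have v_rho : (\int[rho]_g (v g)%:E <=
    \int[rho]_g (\int[Q]_P ereal_inf
       [set \int[(P : probability (X * Y)%type R)]_z (l (h (app g z.1)) z.2)%:E
       | h in Hs] + (beta g m)%:E))%E.
  apply: ge0_le_lower_integral => g; first by rewrite lee_fin; case/andP: (v_bnd g).
  apply: (risk_le app Hs l alg m m0 l0 mavg Q g _ C) => //.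
  - by move=> g' S; case/andP: (avgC g' S).
  - exact: (measurableT_comp minf (measurable_pair1 g)).
apply: le_trans (leeD (leeD v_rho (lexx _)) (lexx _)).
rewrite (rmeanE rho v C mv v_bnd).
(* An infinite divergence makes the bound trivial; a finite one forces [rho] to be absolutely
   continuous. *)
have := KL_ge0 rho pi1; case KLk : (KL rho pi1) => [k| |]// _; last first.
  by rewrite gt0_mulye ?lte_fin// addey ?leey.
have rho_pi1 : rho `<< pi1.
  by have [//|nrho_pi1] := pselect (rho `<< pi1); move: KLk; rewrite /KL; case: (pselect _).
have Ti0 : 0 <= T%:R^-1 :> R by rewrite invr_ge0.
apply: (le_trans _ (le_trans (tasksE_ewa_le Q pi1 m L C eta mavg avgC eta0 rho
  rho_pi1 k T [::] 0 T%:R^-1 KLk (lexx _) Ti0) _)).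
  rewrite le_eqVlt; apply/orP; left; apply/eqP; congr tasksE.
  by apply/funext => D; rewrite add0e.
rewrite -EFinM -!EFinD lee_fin le_eqVlt; apply/orP; left; apply/eqP.
(* Before any task the potential is just [k], which after division by [eta] and scaling by [1 / T]
   is the divergence term. *)
rewrite /potential partition_fun_nil ln1 addr0 (_ : cumloss m L [::] = cst 0); last first.
  by apply/funext => g; rewrite /cumloss big_nil.
have -> : wmean rho (cst 1) (cst 0) = 0.
  by rewrite /wmean integral0_eq// => g _; rewrite mul0r.
field.
by rewrite !gt_eqF// ltr0n.
Qed.
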